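(* Let $k>0$ be an integer and let $a_0,a_1,\ldots,a_k$ be fixed integers. For each integer $n>k$ let $$P_{2n}(x)=x^n\Big(x^n+a_0+x^{-n}+\sum_{j=1}^k a_j\big(x^j+x^{-j}\big)\Big),$$ a monic reciprocal polynomial of degree $2n$ with integer coefficients. Then the limit $\lim_{n\to\infty} C(P_{2n})$ exists.
   Context: For a polynomial $P$ of degree $d$, let $I(P)$, $U(P)$, $E(P)$ denote the numbers of complex zeros of $P$ (counted with multiplicity) of modulus $<1$, $=1$, $>1$ respectively, so $I(P)+U(P)+E(P)=d$. For the polynomial $P_{2n}$ of degree $2n$, define $C(P_{2n})=\frac{I(P_{2n})+E(P_{2n})}{2n}$, the proportion of zeros that are not on the unit circle. *)

(* Defs.v *)
(* for the polynomial / complex-root part (algC = algebraic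
   complex numbers, an algebraically closed field with a norm; all roots of
   an integer polynomial are algebraic, so this loses nothing).  The limit is
   stated in Stdlib reals. *)
From HB Require Import structures.
From mathcomp Require Import all_boot all_order all_algebra all_field.
Set Implicit Arguments. Unset Strict Implicit. Unset Printing Implicit Defensive.
Import Order.TTheory GRing.Theory Num.Theory.
Local Open Scope ring_scope.

(* The multiset of complex roots of p (with multiplicity), as a sequence r
   with p = lead_coef p * prod_(z in r) (X - z). *)
Definition roots_mult (p : {poly algC}) : seq algC :=
  proj1_sig (closed_field_poly_normal p).

Definition I_count (p : {poly algC}) : nat := count (fun z => `|z| < 1) (roots_mult p).
Definition U_count (p : {poly algC}) : nat := count (fun z => `|z| == 1) (roots_mult p).
Definition E_count (p : {poly algC}) : nat := count (fun z => `|z| > 1) (roots_mult p).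

(* P_{2n}(x) = x^{2n} + a_0 x^n + 1 + sum_{j=1}^k a_j (x^{n+j} + x^{n-j}),
   i.e. x^n (x^n + a_0 + x^{-n} + sum_j a_j (x^j + x^{-j})); meaningful for n > k. *)
Definition P2n (k : nat) (a : nat -> int) (n : nat) : {poly algC} :=
  'X^(2 * n) + (a 0%N)%:~R *: 'X^n + 1
  + \sum_(1 <= j < k.+1) (a j)%:~R *: ('X^(n + j) + 'X^(n - j)).

(* numerator of C(P_{2n}) = (I + E) / (2n) *)
Definition off_circle (p : {poly algC}) : nat := (I_count p + E_count p)%N.

(* Main.v *)
(** On the unit circle [P_{2n} = x^n f] with [f t = 2 cos (n t) + g t] and [g] a fixed
    real cosine polynomial, so a zero at angle [t] means [|g t| <= 2] and
    [n t = +- acos (- g t / 2)] modulo [2 pi].  Cut the circle into the [2n] arcs on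
    which [cos (n t)] is monotone.  An arc on which [|g| < 2] carries exactly one zero
    and an arc on which [|g| > 2] carries none, except for boundedly many arcs: two
    zeros in the same arc force, by Rolle applied to [n t - acos (- g t / 2)], a zero
    of [n^2 (4 - g^2) - g'^2], a nonzero trigonometric polynomial of degree at most
    [2k], and the same polynomial absorbs the multiple zeros.  Hence, up to [O(1)], the
    number of unimodular zeros is the number [c n] of arcs whose first endpoint
    satisfies [|g| < 2].  Refining the [n]-arcs into [nm]-arcs gives
    [c (nm) = m c n + O(m)], so [c n / 2n] is a Cauchy sequence.

    The zeros live in [algC]; they are transported to [R[i]] along an order-preserving
    embedding of the real algebraic numbers, defined by Dedekind cuts, so that
    unimodularity is preserved. *)
Require Import Defs.
From Stdlib Require Import Reals Lra.
From HB Require Import structures.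
From mathcomp Require Import all_boot.

(** * Convergence of averages from a cross-multiplied comparison *)

Section RatioLimit.
Local Open Scope R_scope.

(** Dividing the hypothesis by [2 n m] bounds the difference of two quotients by
    [(C / 2) (1 / n + 1 / m)]. The hypothesis is symmetric in [n] and [m], so this one-sided bound
    already gives the Cauchy criterion. *)
Lemma ratio_cv (u : nat -> nat) (k C : nat) :
  (forall n m : nat, (k < n)%N -> (k < m)%N -> (m * u n <= n * u m + (n + m) * C)%N) ->
  exists L : R, Un_cv (fun m : nat => INR (u (m + k + 1)%N) / INR (2 * (m + k + 1))%N) L.
Proof.
move=> uC; suff cau : Cauchy_crit (fun m : nat => INR (u (m + k + 1)%N) / INR (2 * (m + k + 1))%N).
  by have [L uL] := R_complete _ cau; exists L.
move=> eps eps0; have [M CM] := INR_unbounded (INR C / eps).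
have close n m : (k < n)%N -> (k < m)%N -> (M <= n)%N -> (M <= m)%N ->
    INR (u n) / INR (2 * n)%N - INR (u m) / INR (2 * m)%N < eps.
  move=> kn km Mn Mm.
  have big j : (M <= j)%N -> INR C < eps * INR j.
    move=> Mj; have jM : INR M <= INR j by apply/le_INR/leP.
    have : INR C / eps * eps < INR j * eps by apply: Rmult_lt_compat_r; lra.
    by rewrite /Rdiv Rmult_assoc Rinv_l; lra.
  have pos j : (k < j)%N -> 0 < INR j by move=> kj; apply/lt_0_INR/ltP/(leq_ltn_trans _ kj).
  have : INR (m * u n)%N <= INR (n * u m + (n + m) * C)%N by apply/le_INR/leP/uC.
  rewrite plus_INR !mult_INR plus_INR.
  move: (big n Mn) (big m Mm) (pos n kn) (pos m km).
  move: (INR n) (INR m) (INR (u n)) (INR (u m)) (INR C) => N N' X X' c cN cN' N0 N'0 le.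
  have -> : X / (INR 2 * N) - X' / (INR 2 * N') = (N' * X - N * X') / (2 * N * N').
    by rewrite /=; field; split; lra.
  have NN : 0 < 2 * N * N' by nra.
  apply: (Rmult_lt_reg_r _ _ _ NN); rewrite /Rdiv Rmult_assoc Rinv_l; last lra.
  nra.
have kj j : (k < j + k + 1)%N by rewrite addn1 ltnS leq_addl.
have Mj j : (M <= j -> M <= j + k + 1)%N by move=> Mj; rewrite -addnA; apply: leq_trans (leq_addr _ _).
exists M => n m /leP/Mj Mn /leP/Mj Mm.
have [nm mn] := (close _ _ (kj n) (kj m) Mn Mm, close _ _ (kj m) (kj n) Mm Mn).
by apply: Rabs_def1; lra.
Qed.
End RatioLimit.

From mathcomp Require Import all_order all_algebra all_field.
From mathcomp Require Import Rstruct.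
From mathcomp Require Import all_classical all_reals all_analysis.
From mathcomp Require Import complex.
From mathcomp Require Import ring lra zify.
Set Implicit Arguments. Unset Strict Implicit. Unset Printing Implicit Defensive.
Import Order.TTheory GRing.Theory Num.Theory.
Import numFieldNormedType.Exports.
Local Open Scope ring_scope.

(** * Embedding the algebraic numbers *)

Definition cut_embed (F : archiRealFieldType) (R : realType) (x : F) : R :=
  sup [set ratr q | q in [set q : rat | ratr q < x]]%classic.

Section CutEmbed.
Variables (F : archiRealFieldType) (R : realType).
Implicit Types x y : F.
Local Notation phi := (@cut_embed F R).

(** Density of the rationals in both fields makes the cut of [phi x] the cut of [x]. With
    [eq_ratr_cut], every identity about [phi] reduces to a comparison of cuts. *)
Lemma ratr_lt_cut q x : (ratr q < phi x) = (ratr q < x).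
Proof.
pose S := [set ratr q | q in [set q : rat | ratr q < x]]%classic : set R.
have Sx0 : (S !=set0)%classic.
  have [|p] := @rat_in_itvoo F (x - 1) x; first by rewrite ltrBlDr ltrDl.
  by rewrite in_itv /= => /andP[_ px]; exists (ratr p), p.
have Sub (p : rat) : x <= ratr p -> ubound S (ratr p).
  by move=> xp _ [r /= rx <-]; rewrite ler_rat -(@ler_rat F) (le_trans (ltW rx)).
have Ssup : has_sup S.
  split=> //; have [|p] := @rat_in_itvoo F x (x + 1); first by rewrite ltrDl.
  by rewrite in_itv /= => /andP[/ltW xp _]; exists (ratr p); apply: Sub.
apply/idP/idP => [qphi | /rat_in_itvoo[p]].
  by rewrite ltNge; apply: contraL qphi => /Sub qS; rewrite -leNgt ge_sup.
rewrite in_itv /= ltr_rat => /andP[qp px].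
rewrite (@lt_le_trans _ _ (ratr p)) ?ltr_rat //.
by apply: ub_le_sup; [case: Ssup | exists p].
Qed.

Lemma eq_ratr_cut (a b : R) : (forall q, (ratr q < a) = (ratr q < b)) -> a = b.
Proof.
move=> ab; apply/le_anti; rewrite !leNgt; apply/andP; split; apply/negP => /rat_in_itvoo[q];
  by rewrite in_itv /= => /andP[q1 q2]; have := ab q; rewrite ?q1 ?q2 ltNge ltW.
Qed.

(* Cuts of sums and products are described by rational inequalities that read the same in
   the source and in the target; this is why the embedding is a ring morphism. *)
Lemma ratr_lt_add (K : archiRealFieldType) q (x y : K) :
  ratr q < x + y <-> exists p : rat, ratr p < x /\ ratr (q - p) < y.
Proof.
rewrite -ltrBlDr; split=> [/rat_in_itvoo[p]|[p [px]]].
  by rewrite in_itv /= => /andP[qp px]; exists p; rewrite rmorphB /=; split=> //; lra.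
by rewrite rmorphB /= => qy; lra.
Qed.

(** The case [q <= 0] is kept apart because for [q > 0] the separating rational [p], lying between
    [q / y] and [x], is automatically positive. *)
Lemma ratr_lt_mul (K : archiRealFieldType) q (x y : K) : 0 < x -> 0 < y ->
  ratr q < x * y <-> q <= 0 \/ exists p : rat, [/\ 0 < p, ratr p < x & ratr (q / p) < y].
Proof.
move=> x0 y0; split=> [|[q0|[p [p0 px]]]].
- have [|q0] := leP q 0; [by left | right].
  move: H; rewrite -ltr_pdivrMr // => /rat_in_itvoo[p]; rewrite in_itv /= => /andP[qp px].
  have p0 : (0 : K) < ratr p by rewrite (le_lt_trans _ qp) // divr_ge0 ?ler0q ?ltW.
  exists p; split=> //; first by rewrite -(ltr0q K).
  by rewrite rmorphM fmorphV /= ltr_pdivrMr // mulrC -ltr_pdivrMr.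
- by rewrite (le_lt_trans _ (mulr_gt0 x0 y0)) // lerq0.
- rewrite rmorphM fmorphV /= ltr_pdivrMr ?ltr0q // => qpy.
  by rewrite (lt_trans qpy) // mulrC ltr_pM2r.
Qed.

Lemma cut_embedD : {morph phi : x y / x + y}.
Proof.
move=> x y; apply: eq_ratr_cut => q; rewrite ratr_lt_cut.
by apply/idP/idP => /ratr_lt_add[p [p1 p2]]; apply/ratr_lt_add; exists p;
  move: p1 p2; rewrite !ratr_lt_cut.
Qed.

Lemma cut_embed0 : phi 0 = 0.
Proof. by have := cut_embedD 0 0; rewrite addr0 => /(congr1 (+%R^~ (- phi 0))); rewrite subrr addrK. Qed.

Lemma cut_embedB : {morph phi : x y / x - y}.
Proof.
by move=> x y; apply/eqP; rewrite eq_sym subr_eq -cut_embedD subrK.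
Qed.

Lemma cut_embedN : {morph phi : x / - x}.
Proof. by move=> x; rewrite -sub0r cut_embedB cut_embed0 sub0r. Qed.

Lemma cut_embed_gt0 x : 0 < x -> 0 < phi x.
Proof. by have := ratr_lt_cut 0 x; rewrite !rmorph0 => ->. Qed.

Lemma cut_embedM : {morph phi : x y / x * y}.
Proof.
have pos x y : 0 < x -> 0 < y -> phi (x * y) = phi x * phi y.
  move=> x0 y0; have [px py] := (cut_embed_gt0 x0, cut_embed_gt0 y0).
  apply: eq_ratr_cut => q; rewrite ratr_lt_cut.
  apply/idP/idP => [/(ratr_lt_mul q x0 y0)|/(ratr_lt_mul q px py)] [q0|[p [p0 p1 p2]]].
  - by apply/(ratr_lt_mul q px py); left.
  - by apply/(ratr_lt_mul q px py); right; exists p; rewrite !ratr_lt_cut.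
  - by apply/(ratr_lt_mul q x0 y0); left.
  - by apply/(ratr_lt_mul q x0 y0); right; exists p; move: p1 p2; rewrite !ratr_lt_cut.
(* Oddness of [phi] carries the positive case to arbitrary signs, one factor at a time. *)
have posl x y : 0 < x -> phi (x * y) = phi x * phi y.
  move=> x0; have [y0|y0|->] := ltgtP y 0; [|exact: pos|by rewrite !(mulr0, cut_embed0)].
  by apply: oppr_inj; rewrite -mulrN -!cut_embedN -mulrN pos // oppr_gt0.
move=> x y; have [x0|x0|->] := ltgtP x 0; [|exact: posl|by rewrite !(mul0r, cut_embed0)].
by apply: oppr_inj; rewrite -mulNr -!cut_embedN -mulNr posl // oppr_gt0.
Qed.

Lemma cut_embed1 : phi 1 = 1.
Proof.
have p0 : phi 1 != 0 by rewrite gt_eqF // cut_embed_gt0.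
by apply: (mulfI p0); rewrite -cut_embedM !mulr1.
Qed.

End CutEmbed.

HB.instance Definition _ (F : archiRealFieldType) (R : realType) :=
  GRing.isZmodMorphism.Build F R (@cut_embed F R) (@cut_embedB F R).
HB.instance Definition _ (F : archiRealFieldType) (R : realType) :=
  GRing.isMonoidMorphism.Build F R (@cut_embed F R)
    (conj (@cut_embed1 F R) (@cut_embedM F R)).

Definition algC_embed (R : realType) (z : algC) : R[i] :=
  Complex (cut_embed R (in_algR (Creal_Re z))) (cut_embed R (in_algR (Creal_Im z))).

Section AlgCEmbed.
Variable R : realType.

Lemma algC_embed_is_zmod_morphism : zmod_morphism (@algC_embed R).
Proof.
move=> x y; rewrite /algC_embed; simpc.
rewrite -!cut_embedB.
have -> : in_algR (Creal_Re (x - y)) = in_algR (Creal_Re x) - in_algR (Creal_Re y).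
  by apply: val_inj; rewrite /= raddfB.
have -> // : in_algR (Creal_Im (x - y)) = in_algR (Creal_Im x) - in_algR (Creal_Im y).
by apply: val_inj; rewrite /= raddfB.
Qed.

Lemma algC_embed_is_monoid_morphism : monoid_morphism (@algC_embed R).
Proof.
split=> [|x y].
  rewrite /algC_embed.
  have -> : in_algR (Creal_Re 1) = 1 by apply/val_inj/Creal_ReP/rpred1.
  have -> : in_algR (Creal_Im 1) = 0 by apply/val_inj/Creal_ImP/rpred1.
  by rewrite cut_embed1 cut_embed0.
rewrite /algC_embed; simpc; rewrite -!cut_embedM -cut_embedB -cut_embedD.
have -> : in_algR (Creal_Re (x * y)) = in_algR (Creal_Re x) * in_algR (Creal_Re y)
    - in_algR (Creal_Im x) * in_algR (Creal_Im y) by apply: val_inj; rewrite /= ReM.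
have -> // : in_algR (Creal_Im (x * y)) = in_algR (Creal_Re x) * in_algR (Creal_Im y)
    + in_algR (Creal_Im x) * in_algR (Creal_Re y).
by apply: val_inj; rewrite /= ImM ['Im x * _]mulrC.
Qed.

End AlgCEmbed.

HB.instance Definition _ (R : realType) :=
  GRing.isZmodMorphism.Build algC R[i] (@algC_embed R) (@algC_embed_is_zmod_morphism R).
HB.instance Definition _ (R : realType) :=
  GRing.isMonoidMorphism.Build algC R[i] (@algC_embed R) (@algC_embed_is_monoid_morphism R).

(** After squaring, modulus one is the polynomial identity [Re^2 + Im^2 = 1], which an injective
    ring morphism preserves and reflects. *)
Lemma norm_algC_embed_eq1 (R : realType) (z : algC) :
  (`|@algC_embed R z| == 1) = (`|z| == 1).
Proof.
rewrite -(@eqrXn2 _ 2 `|z|) // expr1n normC2_Re_Im.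
rewrite normc_def /= eq_complex /= eqxx andbT.
rewrite -(@eqrXn2 _ 2) ?sqrtr_ge0 // sqr_sqrtr ?addr_ge0 ?sqr_ge0 // expr1n.
rewrite -!rmorphXn -rmorphD -(rmorph1 (@cut_embed algR R)) (inj_eq (fmorph_inj _)).
by rewrite -(inj_eq val_inj).
Qed.

(** * Multiplicities *)

(** Induction by Leibniz: in [((X - z) q)' = q + (X - z) q'] the first term lacks the factor
    [X - z], and [R] supplies it. *)
Lemma dvdp_prod_XsubC_deriv (F : fieldType) (s : seq F) (R : {poly F}) :
  (forall z, z \in s -> root R z) ->
  \prod_(z <- s) ('X - z%:P) %| (\prod_(z <- s) ('X - z%:P))^`() * R.
Proof.
elim: s => [|z s IHs] Rs; first by rewrite big_nil derivC mul0r dvdp0.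
rewrite big_cons derivM derivXsubC mul1r [X in _ %| X]mulrDl; apply: dvdp_add.
  by rewrite mulrC dvdp_mul // dvdp_XsubCl Rs ?mem_head.
by rewrite -mulrA dvdp_mul // IHs // => y ys; rewrite Rs // inE ys orbT.
Qed.

(* Each root counted beyond its first occurrence is a common root of the product and of its
   derivative. *)
Lemma size_undup_excess (F : fieldType) (r : seq F) (Q : {poly F}) : Q != 0 ->
  (forall S : {poly F}, S %| \prod_(z <- r) ('X - z%:P) ->
     S %| (\prod_(z <- r) ('X - z%:P))^`() -> S %| Q) ->
  (size r < size (undup r) + size Q)%N.
Proof.
(* [s] lists the occurrences of roots beyond the first one; the divisor used below is the product
   over [s], whose degree is the excess to be bounded. *)
move=> Q0 SQ; have [s rs] := perm_to_subseq (undup_subseq r).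
rewrite (perm_size rs) size_cat ltn_add2l -(size_prod_XsubC s id) dvdp_leq //.
have PE : \prod_(z <- r) ('X - z%:P) =
    \prod_(z <- s) ('X - z%:P) * \prod_(z <- undup r) ('X - z%:P).
  by rewrite (perm_big _ rs) big_cat mulrC.
apply: SQ; rewrite PE; first exact: dvdp_mulr.
rewrite derivM; apply: dvdp_add; last exact: dvdp_mulr.
apply: dvdp_prod_XsubC_deriv => z zs.
by rewrite root_prod_XsubC mem_undup (perm_mem rs) mem_cat zs orbT.
Qed.

(** [P2n] over an arbitrary ring, so that one polynomial can be studied in [algC] and in [R[i]]. *)
Definition trin (F : nzRingType) (k : nat) (a : nat -> int) (n : nat) : {poly F} :=
  'X^(2 * n) + (a 0%N)%:~R *: 'X^n + 1
  + \sum_(1 <= j < k.+1) (a j)%:~R *: ('X^(n + j) + 'X^(n - j)).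

(* On the unit circle, [core = x^k g] and [dcore = - i x^k g'], where
   [g = a_0 + sum_j a_j (x^j + x^-j)] and ['] is the derivative in the angle. *)
Definition core (F : nzRingType) (k : nat) (a : nat -> int) : {poly F} :=
  (a 0%N)%:~R *: 'X^k + \sum_(1 <= j < k.+1) (a j)%:~R *: ('X^(k + j) + 'X^(k - j)).

Definition dcore (F : nzRingType) (k : nat) (a : nat -> int) : {poly F} :=
  \sum_(1 <= j < k.+1) ((a j)%:~R * j%:R) *: ('X^(k + j) - 'X^(k - j)).

(* [x^2k (n^2 (4 - g^2) - g'^2)]. *)
Definition disc (F : nzRingType) (k : nat) (a : nat -> int) (n : nat) : {poly F} :=
  (n ^ 2)%:R *: (4 *: 'X^(2 * k) - core F k a ^+ 2) + dcore F k a ^+ 2.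

(** The operator [x d/dx] is diagonal on monomials, without a special case at exponent zero; on the
    unit circle it is [- i d/dt]. *)
Lemma mulX_derivXn (F : nzRingType) m : 'X * ('X^m)^`() = m%:R *: 'X^m :> {poly F}.
Proof.
by case: m => [|m]; rewrite derivXn ?mulr0n ?mulr0 ?scale0r // mulrnAr -exprS scaler_nat.
Qed.

(** * The polynomial [disc] and the repeated zeros of [P_{2n}] *)

Section Algebra.
Variables (F : numFieldType) (k : nat) (a : nat -> int).
Local Notation A := (core F k a).
Local Notation D := (dcore F k a).
Local Notation P := (trin F k a).
Local Notation Q := (disc F k a).

Lemma trinE n : (k <= n)%N -> P n = 'X^(2 * n) + 1 + 'X^(n - k) * A.
Proof.
move=> kn; rewrite /trin /core mulrDr -scalerAr -exprD subnK //.
rewrite mulr_sumr -!addrA; congr (_ + _); rewrite addrCA; do 2!congr (_ + _).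
rewrite big_nat_cond [in RHS]big_nat_cond; apply: eq_bigr => j /andP[/andP[j1 jk] _].
rewrite -scalerAr mulrDr -!exprD; congr (_ *: ('X^_ + 'X^_)); lia.
Qed.

Lemma mulX_deriv_core : 'X * A^`() = k%:R *: A + D.
Proof.
rewrite /core /dcore derivD derivZ mulrDr -scalerAr mulX_derivXn scalerDr -addrA scalerA mulrC -scalerA.
congr (_ + _); rewrite raddf_sum mulr_sumr scaler_sumr -big_split /=.
rewrite big_nat_cond [in RHS]big_nat_cond; apply: eq_bigr => j /andP[/andP[j1 jk] _].
rewrite derivZ derivD -scalerAr mulrDr !mulX_derivXn natrD natrB //.
by rewrite -!mul_polyC; ring.
Qed.

(* If [f = f' = 0] then [2 cos (n t) = - g] and [2 n sin (n t) = g'], so [n^2 (4 - g^2) = g'^2];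
   the divisibility keeps track of multiplicities. *)
Lemma disc_dvd n S : (k <= n)%N -> S %| P n -> S %| (P n)^`() ->
  S %| 'X^(2 * (n - k)) * Q n.
Proof.
move=> kn SP SP'; pose Y : {poly F} := 'X^(n - k); pose w : {poly F} := 'X^k.
have Xn : 'X^n = Y * w by rewrite -exprD subnK.
have PE : P n = Y ^+ 2 * w ^+ 2 + 1 + Y * A by rewrite trinE // mulnC exprM Xn exprMn.
have TE : 'X * (P n)^`() = n%:R *: (P n + Y ^+ 2 * w ^+ 2 - 1) + Y * D.
  rewrite {1}trinE // !derivD derivM derivC addr0 addrA.
  have -> : 'X * (('X^(2 * n))^`() + 'X^(n - k)^`() * A + 'X^(n - k) * A^`())
    = 'X * ('X^(2 * n))^`() + ('X * 'X^(n - k)^`()) * A + 'X^(n - k) * ('X * A^`()) by ring.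
  rewrite !mulX_derivXn mulX_deriv_core -/Y mulnC exprM Xn exprMn natrM natrB // PE.
  by rewrite -!mul_polyC; ring.
have -> : 'X^(2 * (n - k)) * Q n = Y ^+ 2 * Q n by rewrite mulnC exprM.
(* On the circle [P = x^n f] and [T = - i x^n f']. Up to the terms [2 n Y^2 w^2] and [2 n], the
   combinations [n P + T] and [n P - T] are [Y (n A + D)] and [Y (n A - D)]; multiplying the latter
   two gives the next identity. *)
pose T := 'X * (P n)^`() - n%:R *: P n.
have -> : Y ^+ 2 * Q n = - (n%:R *: P n - T) * (n%:R *: P n + T)
   + 2 * n%:R *: (n%:R *: P n + T) + (2 * n%:R *: (Y ^+ 2 * w ^+ 2)) * (n%:R *: P n - T).
  rewrite /T TE PE /disc mulnC exprM -/w natrX -!mul_polyC.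
  by ring.
have SnP : S %| n%:R *: P n by rewrite -mul_polyC dvdp_mull.
have ST : S %| T by rewrite dvdp_sub // dvdp_mull.
have [Sp Sm] : S %| n%:R *: P n + T /\ S %| n%:R *: P n - T.
  by split; [apply: dvdp_add | apply: dvdp_sub].
by rewrite dvdp_add ?dvdp_add ?dvdp_mull // -mul_polyC dvdp_mull.
Qed.

Lemma coef_core_gt i : (2 * k < i)%N -> A`_i = 0.
Proof.
move=> ki; rewrite /core coefD coefZ coefXn coef_sum big_nat_cond big1 => [|j /andP[jk _]].
  have -> : (i == k) = false by lia.
  by rewrite mulr0 addr0.
rewrite coefZ coefD !coefXn; have -> : (i == k + j)%N = false by lia.
have -> : (i == k - j)%N = false by lia.
by rewrite addr0 mulr0.
Qed.

Lemma coef_dcore_gt i : (2 * k < i)%N -> D`_i = 0.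
Proof.
move=> ki; rewrite /dcore coef_sum big_nat_cond big1 // => j /andP[jk _].
rewrite coefZ coefB !coefXn; have -> : (i == k + j)%N = false by lia.
have -> : (i == k - j)%N = false by lia.
by rewrite subr0 mulr0.
Qed.

Lemma coef_core j : (0 < j <= k)%N -> A`_(k + j) = (a j)%:~R.
Proof.
move=> jk; rewrite /core coefD coefZ coefXn coef_sum.
have -> : (k + j == k)%N = false by lia.
rewrite mulr0 add0r (bigD1_seq j) ?iota_uniq ?mem_index_iota //= big1_seq => [|i].
  rewrite coefZ coefD !coefXn eqxx; have -> : (k + j == k - j)%N = false by lia.
  by rewrite !addr0 mulr1.
rewrite mem_index_iota => /andP[ij ik].
rewrite coefZ coefD !coefXn; have -> : (k + j == k + i)%N = false by lia.
have -> : (k + j == k - i)%N = false by lia.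
by rewrite addr0 mulr0.
Qed.

Lemma coef_dcore j : (0 < j <= k)%N -> D`_(k + j) = (a j)%:~R * j%:R.
Proof.
move=> jk; rewrite /dcore coef_sum.
rewrite (bigD1_seq j) ?iota_uniq ?mem_index_iota //= big1_seq => [|i].
  rewrite coefZ coefB !coefXn eqxx; have -> : (k + j == k - j)%N = false by lia.
  by rewrite addr0 subr0 mulr1.
rewrite mem_index_iota => /andP[ij ik].
rewrite coefZ coefB !coefXn; have -> : (k + j == k + i)%N = false by lia.
have -> : (k + j == k - i)%N = false by lia.
by rewrite subr0 mulr0.
Qed.

Lemma size_disc n : (size (Q n) <= (4 * k).+1)%N.
Proof.
have sA : (size A <= (2 * k).+1)%N by apply/leq_sizeP => i; apply: coef_core_gt.
have sD : (size D <= (2 * k).+1)%N by apply/leq_sizeP => i; apply: coef_dcore_gt.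
have sq (p : {poly F}) : (size p <= (2 * k).+1 -> size (p ^+ 2)%R <= (4 * k).+1)%N.
  by move=> sp; rewrite (leq_trans (size_poly_exp_leq _ _)) //; lia.
rewrite (leq_trans (size_polyD _ _)) // geq_max sq // andbT.
rewrite (leq_trans (size_scale_leq _ _)) // (leq_trans (size_polyD _ _)) // geq_max.
rewrite size_polyN sq // andbT (leq_trans (size_scale_leq _ _)) // size_polyXn; lia.
Qed.

(** If [Q n = 0], then [(n A - D) (n A + D) = 4 n^2 X^(2k)]. When some [a j] with [1 <= j <= k] is
    nonzero, the factors have coefficients [a_j (n - j)] and [a_j (n + j)] at [X^(k + j)], nonzero
    as [j <= k < n], so the product has degree above [2k]. Otherwise [D = 0] and the hypothesis on
    [A] applies. *)
Lemma disc_neq0 n : (k < n)%N -> A ^+ 2 != 4 *: 'X^(2 * k) -> Q n != 0.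
Proof.
move=> kn A2; have [/hasP[j]|noj] := boolP (has (fun j => a j != 0) (index_iota 1 k.+1)).
  rewrite mem_index_iota => jk aj; apply/eqP => Q0.
  have QE : (n ^ 2 * 4)%:R *: 'X^(2 * k) = (n%:R *: A - D) * (n%:R *: A + D).
    apply/eqP; rewrite -subr_eq0 -Q0 /disc natrM natrX; apply/eqP.
    by rewrite -!mul_polyC; ring.
  have aj0 : (a j)%:~R != 0 :> F by rewrite intr_eq0.
  have sB : (k + j < size (n%:R *: A - D)%R)%N.
    rewrite ltnNge; apply/negP => /leq_sizeP/(_ _ (leqnn _))/eqP.
    rewrite coefB coefZ coef_core // coef_dcore // mulrC -mulrBr mulf_eq0 (negPf aj0) /=.
    by rewrite subr_eq0 eqr_nat; lia.
  have sD : (k + j < size (n%:R *: A + D)%R)%N.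
    rewrite ltnNge; apply/negP => /leq_sizeP/(_ _ (leqnn _))/eqP.
    rewrite coefD coefZ coef_core // coef_dcore // mulrC -mulrDr mulf_eq0 (negPf aj0) /=.
    by rewrite -natrD pnatr_eq0; lia.
  have := congr1 (fun p : {poly F} => size p) QE.
  rewrite size_mul -?size_poly_gt0 ?(leq_trans _ sB) ?(leq_trans _ sD) //.
  have := size_scale_leq ((n ^ 2 * 4)%:R : F) 'X^(2 * k); rewrite size_polyXn.
  by move: jk sB sD; move: (size _) (size _) (size _) => s1 s2 s3; lia.
have a0 j : (0 < j <= k)%N -> a j = 0.
  move=> jk; apply/eqP; apply: contraNT noj => aj; apply/hasP; exists j => //.
  by rewrite mem_index_iota.
have DE : D = 0.
  rewrite /dcore big_nat_cond big1 // => j /andP[jk _].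
  by rewrite a0 ?mul0r ?scale0r //; lia.
rewrite /disc DE expr0n addr0 scaler_eq0 pnatr_eq0 subr_eq0 [4 *: _ == _]eq_sym (negPf A2) orbF; lia.
Qed.

Lemma trin_root0 n : (k < n)%N -> ~~ root (P n) 0.
Proof.
move=> kn; rewrite trinE ?(ltnW kn) // rootE !hornerE.
have -> : (2 * n = (2 * n).-1.+1)%N by lia.
have -> : (n - k = (n - k).-1.+1)%N by lia.
by rewrite !expr0n /= mul0r addr0 add0r oner_eq0.
Qed.

(** By [disc_dvd] a common divisor of [P] and [P'] divides a power of [X] times [Q]. Since [P] does
    not vanish at zero, it divides [Q], whose degree is bounded independently of [n]. *)
Lemma trin_excess n (r : seq F) : (k < n)%N -> A ^+ 2 != 4 *: 'X^(2 * k) ->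
  P n = \prod_(z <- r) ('X - z%:P) -> (size r <= size (undup r) + 4 * k)%N.
Proof.
move=> kn A2 Pr; have Q0 := disc_neq0 kn A2.
have: (size r < size (undup r) + size (Q n))%N.
  apply: size_undup_excess => // S; rewrite -Pr => SP SP'.
  have := disc_dvd (ltnW kn) SP SP'; rewrite Gauss_dvdpr //.
  apply: coprimep_expr; apply: coprimep_dvdr SP _.
  by have := coprimep_XsubC (P n) 0; rewrite subr0 trin_root0.
by have := size_disc n; lia.
Qed.
End Algebra.

(** * Zeros on an arc *)

Lemma cos_natpi (R : realType) m : cos (m%:R * pi) = (-1) ^+ m :> R.
Proof.
elim: m => [|m IHm]; first by rewrite mul0r cos0.
by rewrite -natr1 mulrDl mul1r cosDpi IHm exprS mulN1r.
Qed.

Lemma sin_natpi (R : realType) m : sin (m%:R * pi) = 0 :> R.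
Proof.
elim: m => [|m IHm]; first by rewrite mul0r sin0.
by rewrite -natr1 mulrDl mul1r sinDpi IHm oppr0.
Qed.

Lemma ltr_avoid (R : realType) (h : R -> R) (v x y : R) : continuous h -> x <= y ->
  (forall c, x <= c <= y -> h c != v) -> (h x < v) = (h y < v).
Proof.
move=> hc xy hv; apply/idP/idP => hx; rewrite ltNge; apply/negP => hy.
  have [|c] := @IVT R h x y v xy (continuous_subspaceT hc).
    by rewrite ge_min le_max (ltW hx) hy orbT.
  by rewrite in_itv /= => /hv/eqP.
have [|c] := @IVT R h x y v xy (continuous_subspaceT hc).
  by rewrite ge_min le_max (ltW hx) hy orbT.
by rewrite in_itv /= => /hv/eqP.
Qed.

Section Arc.
Variables (R : realType) (g dg : R -> R).
Hypothesis g_derive : forall t : R, is_derive t 1 g (dg t).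
Variable n : nat.
Hypothesis n0 : (0 < n)%N.

Local Notation f := (fun t : R => 2 * cos (n%:R * t) + g t).

(** Half-open, so that each angle in [[0, 2 pi)] lies in exactly one arc with [m < 2 * n]. *)
Definition nth_arc (m : nat) (t : R) : bool := m%:R * pi <= n%:R * t < m.+1%:R * pi.

Lemma g_cont : continuous g.
Proof. by move=> t; apply/differentiable_continuous/derivable1_diffP; case: (g_derive t). Qed.

Lemma g2_cont : continuous (fun t => g t ^+ 2).
Proof. by move=> t; apply: (@continuous_comp _ _ _ g (fun x => x ^+ 2)); [exact: g_cont | exact: exprn_continuous]. Qed.

Lemma f_cont : continuous f.
Proof.
move=> t; apply: (@cvgD _ R^o); last exact: g_cont.
apply: cvgMl_tmp; apply: (@continuous_comp R R R ( *%R n%:R) (@cos R) t).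
  exact: mulrl_continuous.
exact: continuous_cos.
Qed.

Lemma cos_arc m (t : R) : cos (n%:R * t - m%:R * pi) = (-1) ^+ m * cos (n%:R * t).
Proof. by rewrite cosB cos_natpi sin_natpi mulr0 addr0 mulrC. Qed.

(* The factor [(-1) ^+ m] brings [n t - m pi] into [[0, pi]] for every parity of [m]. *)
Definition phase m (t : R) : R := n%:R * t - m%:R * pi - acos ((-1) ^+ m * (- (g t / 2))).

Lemma phase0 m t : nth_arc m t -> f t = 0 -> phase m t = 0.
Proof.
move=> /andP[m1 m2] ft; have gE : - (g t / 2) = cos (n%:R * t) by lra.
rewrite /phase gE -cos_arc cosK ?subrr // in_itv /= subr_ge0 m1 lerBlDr.
by rewrite (le_trans (ltW m2)) // -natr1 mulrDl mul1r addrC.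
Qed.

Lemma phase_derive m t : g t ^+ 2 < 4 ->
  is_derive t 1 (phase m)
    (n%:R - (-1) ^+ m * (dg t / 2) / Num.sqrt (1 - (g t / 2) ^+ 2)).
Proof.
move=> gt4; have gb : -1 < (-1) ^+ m * (- (g t / 2)) < 1.
  rewrite -ltr_norml normrM normrX normrN1 expr1n mul1r normrN.
  rewrite -(@ltr_pXn2r _ 2) ?nnegrE // expr1n real_normK ?num_real // expr_div_n ltr_pdivrMr //.
  lra.
have da := is_derive1_acos gb.
have dm : is_derive t 1 (fun t => (-1) ^+ m * (- (g t / 2))) ((-1) ^+ m * (- (dg t / 2))).
  have dgt := g_derive t.
  have -> : (fun t => (-1) ^+ m * (- (g t / 2))) = (- ((-1) ^+ m / 2)) \*: g.
    by apply/funext => x /=; rewrite /GRing.scale /=; ring.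
  by apply: is_derive_eq; rewrite /GRing.scale /=; ring.
have dac := @is_derive1_comp R (@acos R) (fun t => (-1) ^+ m * (- (g t / 2))) t _ _ da dm.
have dl : is_derive t 1 (fun t => n%:R * t - m%:R * pi) n%:R.
  have -> : (fun t => n%:R * t - m%:R * pi) = (n%:R \*: id) - cst (m%:R * pi :> R) by [].
  by apply: is_derive_eq; rewrite /GRing.scale /=; ring.
have -> : phase m = (fun t : R => n%:R * t - m%:R * pi)
    - (@acos R \o (fun t => (-1) ^+ m * (- (g t / 2)))) by apply/funext.
apply: (is_derive_eq (is_deriveB dl dac)).
rewrite exprMn -exprM mulnC exprM sqrrN expr1n expr1n mul1r sqrrN; ring.
Qed.

(** If [g^2] avoids 4 between the two zeros, then [|g| < 2] throughout, so [phase m] is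
    differentiable and vanishes at both ends. Rolle gives [n sqrt (1 - g^2 / 4) = +- g' / 2], and
    squaring removes the root and the sign. *)
Lemma arc_Rolle m t1 t2 : nth_arc m t1 -> nth_arc m t2 -> t1 < t2 -> f t1 = 0 -> f t2 = 0 ->
  g t1 ^+ 2 != 4 -> g t2 ^+ 2 != 4 ->
  exists2 c, t1 < c < t2 & g c ^+ 2 = 4 \/ n%:R ^+ 2 * (4 - g c ^+ 2) = dg c ^+ 2.
Proof.
move=> m1 m2 t12 f1 f2 g1 g2.
have [[c ct gc]|noc] := pselect (exists2 c, t1 < c < t2 & g c ^+ 2 = 4).
  by exists c => //; left.
have g4 t : t1 <= t <= t2 -> g t ^+ 2 != 4.
  move=> /andP[]; rewrite !le_eqVlt => /predU1P[<- //|t1t] /predU1P[-> //|tt2].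
  by apply/eqP => gt4; apply: noc; exists t; rewrite ?t1t.
have g1lt : g t1 ^+ 2 < 4.
  rewrite lt_neqAle g1 /=; have gE : g t1 = - 2 * cos (n%:R * t1) by move: f1 => /= f1; lra.
  rewrite gE exprMn -[leRHS]mulr1 (_ : (-2) ^+ 2 = 4); last by ring.
  by rewrite ler_pM2l // -[leRHS](cos2Dsin2 (n%:R * t1)) lerDl sqr_ge0.
have glt t : t1 <= t <= t2 -> g t ^+ 2 < 4.
  move=> /andP[t1t tt2]; rewrite -(ltr_avoid g2_cont t1t) // => c /andP[tc ct].
  by rewrite g4 // tc (le_trans ct).
have [|||c ct dc] := @Rolle R (phase m) t1 t2 t12.
- by move=> t /itvP ht; have [] := phase_derive m (glt t _); rewrite ?ht.
- by apply: derivable_within_continuous => t /itvP ht;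
    have [] := phase_derive m (glt t _); rewrite ?ht.
- by rewrite !phase0.
exists c => //; right.
have ctle : t1 <= c <= t2 by move: ct; rewrite in_itv /= => /andP[/ltW-> /ltW->].
have pc := phase_derive m (glt c ctle).
have := @derive_val _ _ _ _ _ _ _ pc; rewrite (@derive_val _ _ _ _ _ _ _ dc).
have := glt c ctle; set s := Num.sqrt _ => gc.
have s0 : 0 < s by rewrite sqrtr_gt0; nra.
have s2 : s ^+ 2 = 1 - (g c / 2) ^+ 2 by rewrite sqr_sqrtr //; nra.
move=> /eqP; rewrite eq_sym subr_eq0 => /eqP ns.
have nsE : n%:R * s = (-1) ^+ m * (dg c / 2) by rewrite ns divfK ?gt_eqF.
have : (n%:R * s) ^+ 2 = (dg c / 2) ^+ 2.
  by rewrite nsE exprMn -exprM mulnC exprM sqrrN !expr1n mul1r.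
rewrite exprMn s2; lra.
Qed.

(** At the two ends [2 cos (n t)] takes the values [2] and [-2] in some order; as [|g| < 2] there,
    [f] changes sign. *)
Lemma arc_zero m (t1 := m%:R * pi / n%:R) (t2 := m.+1%:R * pi / n%:R) :
  (forall t, t1 <= t <= t2 -> g t ^+ 2 != 4) -> g t1 ^+ 2 < 4 ->
  exists2 t, nth_arc m t & f t = 0.
Proof.
move=> g4 g1; have nR : 0 < n%:R :> R by rewrite ltr0n.
have t12 : t1 <= t2 by rewrite ler_pM2r ?invr_gt0 // ler_pM2r ?pi_gt0 // ler_nat.
have g2 : g t2 ^+ 2 < 4 by rewrite -(ltr_avoid g2_cont t12).
have nt1 : n%:R * t1 = m%:R * pi by rewrite mulrC divfK ?gt_eqF.
have nt2 : n%:R * t2 = m.+1%:R * pi by rewrite mulrC divfK ?gt_eqF.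
have f1 : f t1 = 2 * (-1) ^+ m + g t1 by rewrite /= nt1 cos_natpi.
have f2 : f t2 = - 2 * (-1) ^+ m + g t2 by rewrite /= nt2 cos_natpi exprS; ring.
have gb (x : R) : x ^+ 2 < 4 -> -2 < x < 2 by move=> ?; apply/andP; split; nra.
have [/andP[a1 b1] /andP[a2 b2]] := (gb _ g1, gb _ g2).
have [|t] := @IVT R f t1 t2 0 t12 (continuous_subspaceT f_cont).
  rewrite f1 f2 ge_min le_max -signr_odd.
   case: (odd m); rewrite ?expr1 ?expr0; apply/andP; split; apply/orP;
    by [left; lra | right; lra].
rewrite in_itv /= => /andP[t1t tt2] ft; exists t => //.
rewrite /nth_arc -nt1 -nt2 ler_pM2l // t1t ltr_pM2l // lt_neqAle tt2 andbT.
(* The intermediate value theorem works on the closed arc; the right end, excluded from [nth_arc],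
   is not a zero because [|g t2| < 2]. *)
apply/eqP => tE; move: ft; rewrite tE nt2 cos_natpi exprS -signr_odd.
by case: (odd m); rewrite ?expr1 ?expr0; lra.
Qed.
End Arc.

(** * Counting zeros arc by arc *)

(** The rank of [z], the number of entries of [B] below it, increases strictly along [Z] and takes
    values in [0, ..., size B]. *)
Lemma size_interlace (R : realDomainType) (Z B : seq R) : uniq Z ->
  {in Z &, forall z z', z < z' -> exists2 b, b \in B & z < b < z'} ->
  (size Z <= (size B).+1)%N.
Proof.
move=> Zu ZB; pose r z := count (fun b => b < z) B.
have r_lt : {in Z &, forall z z', z < z' -> (r z < r z')%N}.
  move=> z z' zZ z'Z zz'; have [b bB /andP[zb bz']] := ZB z z' zZ z'Z zz'.
  have := count_predUI (fun b => b < z) (fun b => z <= b < z') B.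
  rewrite (@eq_count _ (predU _ _) (fun b => b < z')) => [|x /=]; last by lra.
  rewrite (@eq_count _ (predI _ _) pred0) => [|x /=]; last by lra.
  rewrite count_pred0 addn0 /r => ->; rewrite -[leqLHS]addn0 ltn_add2l -has_count.
  by apply/hasP; exists b => //; rewrite (ltW zb).
rewrite -(size_iota 0 (size B).+1) -(size_map r); apply: uniq_leq_size.
  rewrite map_inj_in_uniq // => z z' zZ z'Z rzz'.
  by have [/(r_lt _ _ zZ z'Z)|/(r_lt _ _ z'Z zZ)|//] := ltgtP z z'; rewrite rzz' ltnn.
by move=> _ /mapP[z _ ->]; rewrite mem_iota /= add0n ltnS count_size.
Qed.

Section Count.
Variables (R : realType) (n : nat).
Hypothesis n0 : (0 < n)%N.
Implicit Types (t : R) (s : seq R).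

Lemma arc_truncn m t : nth_arc n m t -> m = Num.truncn (n%:R * t / pi).
Proof.
move=> /andP[m1 m2]; apply/esym/truncn_def.
by rewrite ler_pdivlMr ?pi_gt0 // m1 ltr_pdivrMr ?pi_gt0.
Qed.

Lemma sum_arcE N t :
  (\sum_(0 <= m < N) nth_arc n m t)%N = count (fun m => nth_arc n m t) (index_iota 0 N).
Proof. by rewrite -sum1_count [in RHS]big_mkcond. Qed.

Lemma sum_arc_le1 N t : (\sum_(0 <= m < N) nth_arc n m t <= 1)%N.
Proof.
have sub : subpred (fun m => nth_arc n m t) (pred1 (Num.truncn (n%:R * t / pi))).
  by move=> m /arc_truncn/eqP.
by rewrite sum_arcE (leq_trans (sub_count sub _)) // count_uniq_mem ?iota_uniq // leq_b1.
Qed.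

Lemma sum_count_arc N s : (\sum_(0 <= m < N) count (nth_arc n m) s <= size s)%N.
Proof.
elim: s => [|t s IHs]; first by rewrite big1.
by rewrite big_split /= -add1n leq_add // sum_arc_le1.
Qed.

Lemma sum_count_arc_eq s : {in s, forall t, 0 <= t < 2 * pi} ->
  (\sum_(0 <= m < 2 * n) count (nth_arc n m) s)%N = size s.
Proof.
elim: s => [|t s IHs] ts; first by rewrite big1.
rewrite big_split /= IHs => [|x xs]; last by rewrite ts // inE xs orbT.
suff -> : (\sum_(0 <= m < 2 * n) nth_arc n m t = 1)%N by rewrite add1n.
apply/eqP; rewrite eqn_leq sum_arc_le1 sum_arcE -has_count.
have /andP[t0 t2] := ts t (mem_head _ _).
have nt : 0 <= n%:R * t / pi by rewrite divr_ge0 ?pi_ge0 // mulr_ge0.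
apply/hasP; exists (Num.truncn (n%:R * t / pi)).
  rewrite mem_index_iota /= truncn_lt_nat // ltr_pdivrMr ?pi_gt0 // natrM mulrAC mulrC.
  by rewrite ltr_pM2r ?ltr0n.
have := truncn_itv nt.
by rewrite ler_pdivlMr ?pi_gt0 // ltr_pdivrMr ?pi_gt0.
Qed.

Lemma arc_bounds m t : (m < 2 * n)%N -> nth_arc n m t -> 0 <= t < 2 * pi.
Proof.
move=> mn /andP[m1 m2]; have nR : 0 < n%:R :> R by rewrite ltr0n.
have p0 := pi_gt0 R.
have m0 : 0 <= m%:R * pi :> R by rewrite mulr_ge0 ?pi_ge0.
have m2n : m.+1%:R * pi <= n%:R * (2 * pi) :> R.
  by rewrite mulrA -natrM ler_pM2r // ler_nat mulnC.
rewrite -(pmulr_rge0 t nR) (le_trans m0 m1) /=.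
by rewrite -(ltr_pM2l nR); apply: lt_le_trans m2 m2n.
Qed.

Variables (g dg : R -> R).
Hypothesis g_derive : forall t, is_derive t (1 : R) g (dg t).

Lemma arc_first m : nth_arc n m (m%:R * pi / n%:R : R).
Proof.
have nx : n%:R * (m%:R * pi / n%:R) = m%:R * pi :> R.
  by rewrite mulrC divfK // pnatr_eq0 -lt0n.
by rewrite /nth_arc nx lexx ltr_pM2r ?pi_gt0 ?ltr_nat /=.
Qed.

Lemma arc_first_le m t : nth_arc n m t -> m%:R * pi / n%:R <= t.
Proof. by move=> /andP[m1 _]; rewrite ler_pdivrMr ?ltr0n // [t * _]mulrC. Qed.

Lemma arc_btw m t t' c : nth_arc n m t -> nth_arc n m t' -> t <= c <= t' -> nth_arc n m c.
Proof.
move=> /andP[m1 _] /andP[_ m2] /andP[tc ct].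
by rewrite /nth_arc (le_trans m1) ?(le_lt_trans _ m2) // ler_pM2l ?ltr0n.
Qed.

(** [B] contains every solution of [g^2 = 4], so on an arc that misses [B] the first endpoint
    decides between [|g| < 2] and [|g| > 2] for the whole arc. *)
Lemma arc_status m t (B : seq R) : (m < 2 * n)%N ->
  (forall x : R, 0 <= x <= 2 * pi -> g x ^+ 2 = 4 -> x \in B) ->
  count (nth_arc n m) B = 0%N -> nth_arc n m t ->
  (g (m%:R * pi / n%:R) ^+ 2 < 4) = (g t ^+ 2 < 4).
Proof.
move=> mn gB /eqP; rewrite -leqn0 leqNgt -has_count => /hasPn noB mt.
apply: (ltr_avoid (g2_cont g_derive) (arc_first_le mt)) => c /(arc_btw (arc_first m) mt) mc.
apply/eqP => gc; have /andP[c0 c2] := arc_bounds mn mc.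
have cB : c \in B by apply: gB => //; rewrite c0 ltW.
by have /negP[] := noB c cB.
Qed.

(** The number called [c n] in the overview. *)
Definition low_count : nat := \sum_(0 <= m < 2 * n) (g (m%:R * pi / n%:R) ^+ 2 < 4)%R.

Section Zeros.
Variables Z B : seq R.
Hypothesis Zu : uniq Z.
Hypothesis ZE : forall t, (t \in Z) = (0 <= t < 2 * pi) && (2 * cos (n%:R * t) + g t == 0).
Hypothesis gB : forall x : R, 0 <= x <= 2 * pi -> g x ^+ 2 = 4 -> x \in B.
Hypothesis dB : forall x : R, 0 <= x <= 2 * pi ->
  n%:R ^+ 2 * (4 - g x ^+ 2) = dg x ^+ 2 -> x \in B.

Lemma zero_sqr_le t : t \in Z -> g t ^+ 2 <= 4.
Proof.
rewrite ZE => /andP[_ /eqP ft]; have gE : g t = - 2 * cos (n%:R * t) by lra.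
rewrite gE exprMn -[leRHS]mulr1 (_ : (-2) ^+ 2 = 4); last by ring.
by rewrite ler_pM2l // -[leRHS](cos2Dsin2 (n%:R * t)) lerDl sqr_ge0.
Qed.

(** With [b] points of [B] in the arc, at most [b] zeros lie in [B], and the others are separated by
    points of [B] by [arc_Rolle], so there are at most [b + 1] of them. The total [2 b + 1] is at
    most [3 b] unless [b = 0]. *)
Lemma arc_count_upper m : (m < 2 * n)%N ->
  (count (nth_arc n m) Z <= (g (m%:R * pi / n%:R) ^+ 2 < 4)%R + 3 * count (nth_arc n m) B)%N.
Proof.
move=> mn; pose Zm := [seq x <- Z | nth_arc n m x]; pose Bm := [seq x <- B | nth_arc n m x].
rewrite -!size_filter -/Zm -/Bm.
have Zmu : uniq Zm by rewrite filter_uniq.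
have BmP c t t' : t \in Zm -> t' \in Zm -> t < c < t' -> c \in B -> c \in Bm.
  rewrite !mem_filter => /andP[mt _] /andP[mt' _] /andP[/ltW tc /ltW ct] ->.
  by rewrite (arc_btw mt mt') ?tc.
have Bsz : (size ([seq x <- Zm | x \in B]) <= size Bm)%N.
  apply: uniq_leq_size; first by rewrite filter_uniq.
  by move=> t; rewrite !mem_filter => /and3P[-> -> _].
have nBsz : (size [seq x <- Zm | x \notin B] <= (size Bm).+1)%N.
  apply: size_interlace; first by rewrite filter_uniq.
  move=> t1 t2; rewrite !(mem_filter (fun x => x \notin B)) => /andP[t1B t1Z] /andP[t2B t2Z] t12.
  move: (t1Z) (t2Z); rewrite !mem_filter !ZE.
  move=> /and3P[mt1 t1b /eqP f1] /and3P[mt2 t2b /eqP f2].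
  have nB t : 0 <= t < 2 * pi -> t \notin B -> g t ^+ 2 != 4.
    by move=> /andP[t0 t2']; apply: contra => /eqP gt; rewrite gB // t0 ltW.
  have [c ct gc] := arc_Rolle g_derive mt1 mt2 t12 f1 f2 (nB _ t1b t1B) (nB _ t2b t2B).
  exists c => //; apply: (BmP c t1 t2) => //.
  have cb : 0 <= c <= 2 * pi.
    move: t1b t2b ct => /andP[t10 _] /andP[_ t2p] /andP[t1c ct2].
    by rewrite (le_trans t10 (ltW t1c)) (ltW (lt_trans ct2 t2p)).
  by case: gc; [apply: gB | apply: dB].
have szE : (size [seq x <- Zm | x \in B] + size [seq x <- Zm | x \notin B])%N = size Zm.
  by have := count_predC [in B] Zm; rewrite -!size_filter.
have [Bm0|] := posnP (size Bm); last by lia.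
case: (boolP (g _ ^+ 2 < 4)) => gm; first by lia.
(* An arc without points of [B] whose first endpoint has [|g| >= 2] carries no zero: a zero has
   [|g| <= 2], equality would put it in [B], and strict inequality contradicts [arc_status]. *)
suff -> : Zm = [::] by [].
apply/eqP; rewrite -[_ == _]negbK -has_filter; apply/hasPn => t tZ; apply/negP => mt.
have /andP[/andP[t0 t2] _] : (0 <= t < 2 * pi) && (2 * cos (n%:R * t) + g t == 0) by rewrite -ZE.
have := zero_sqr_le tZ; rewrite le_eqVlt => /predU1P[g4|].
  have : t \in Bm by rewrite mem_filter mt gB // t0 ltW.
  by rewrite (size0nil Bm0).
by rewrite -(arc_status mn gB _ mt) ?(negPf gm) // -size_filter.
Qed.

(** [arc_zero] needs [g^2 != 4] on the closed arc, whose right end belongs to the next arc; hence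
    the count over [m.+1]. *)
Lemma arc_count_lower m : (m < 2 * n)%N ->
  ((g (m%:R * pi / n%:R) ^+ 2 < 4)%R <= count (nth_arc n m) Z
     + (count (nth_arc n m) B + count (nth_arc n m.+1) B))%N.
Proof.
move=> mn; case: (boolP (g _ ^+ 2 < 4)) => // gm.
have [B0|] := posnP (count (nth_arc n m) B + count (nth_arc n m.+1) B); last by lia.
have nB m' : m' \in [:: m; m.+1] -> forall t, t \in B -> ~~ nth_arc n m' t.
  move=> m'm; apply/hasPn; rewrite has_count -leqNgt.
  move/eqP: B0; rewrite addn_eq0 => /andP[/eqP B1 /eqP B2].
  by move: m'm; rewrite !inE => /orP[] /eqP ->; rewrite ?B1 ?B2.
have [|t mt ft] := arc_zero g_derive n0 _ gm; last first.
  rewrite addnC ltn_addl // -has_count; apply/hasP; exists t => //.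
  by rewrite ZE (arc_bounds mn mt) /=; apply/eqP.
have nR : 0 < n%:R :> R by rewrite ltr0n.
have p0 := pi_gt0 R.
move=> t /andP[m1 m2]; apply/eqP => g4.
have tB : t \in B.
  apply: gB => //; apply/andP; split.
    by rewrite (le_trans _ m1) // divr_ge0 ?mulr_ge0 ?pi_ge0.
  rewrite (le_trans m2) // ler_pdivrMr // mulrAC -natrM ler_pM2r // ler_nat; lia.
move: m1 m2; rewrite ler_pdivrMr // ler_pdivlMr // [t * _]mulrC => m1.
rewrite le_eqVlt => /predU1P[m2|m2].
  have m1in : m.+1 \in [:: m; m.+1] by rewrite !inE eqxx orbT.
  apply: (negP (nB _ m1in t tB)).
  by rewrite /nth_arc m2 lexx ltr_pM2r // ltr_nat ltnS leqnn.
by apply: (negP (nB m (mem_head _ _) t tB)); rewrite /nth_arc m1.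
Qed.

Lemma low_count_zeros :
  (size Z <= low_count + 3 * size B /\ low_count <= size Z + 2 * size B)%N.
Proof.
have Zb : {in Z, forall t, 0 <= t < 2 * pi} by move=> t; rewrite ZE => /andP[].
rewrite -(sum_count_arc_eq Zb) /low_count; split.
  apply: (@leq_trans (\sum_(0 <= m < 2 * n) ((g (m%:R * pi / n%:R) ^+ 2 < 4)%R + 3 * count (nth_arc n m) B))%N).
    rewrite big_nat_cond [leqRHS]big_nat_cond; apply: leq_sum => m /andP[/andP[_ mn] _].
    exact: arc_count_upper.
  by rewrite big_split /= leq_add2l -big_distrr leq_mul2l /= sum_count_arc.
apply: (@leq_trans (\sum_(0 <= m < 2 * n) (count (nth_arc n m) Z
     + (count (nth_arc n m) B + count (nth_arc n m.+1) B)))%N).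
  rewrite big_nat_cond [leqRHS]big_nat_cond; apply: leq_sum => m /andP[/andP[_ mn] _].
  exact: arc_count_lower.
rewrite !big_split /= leq_add2l [(2 * size B)%N]mul2n -addnn leq_add ?sum_count_arc //.
(* The shifted index reaches [2 * n], one arc past the full turn; [sum_count_arc] holds for any
   number of arcs. *)
by rewrite (leq_trans _ (sum_count_arc (2 * n).+1 B)) // big_nat_recl // leq_addl.
Qed.
End Zeros.
End Count.

(** The [i]-th of the [n]-arcs is the union of the [nm]-arcs with [i m <= j < (i + 1) m]. If it
    misses [B], all of these have its status; otherwise the error is at most [m], and at most
    [size B] arcs meet [B]. *)
Lemma low_count_refine (R : realType) (g dg : R -> R) (B : seq R) n m :
  (forall t, is_derive t (1 : R) g (dg t)) -> (0 < n)%N -> (0 < m)%N ->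
  (forall x : R, 0 <= x <= 2 * pi -> g x ^+ 2 = 4 -> x \in B) ->
  (low_count (n * m) g <= m * low_count n g + m * size B
   /\ m * low_count n g <= low_count (n * m) g + m * size B)%N.
Proof.
move=> gd n0 m0 gB; rewrite /low_count mulnA big_nat_mul.
pose s i := (g (i%:R * pi / n%:R) ^+ 2 < 4)%R : nat.
pose s' j := (g (j%:R * pi / (n * m)%:R) ^+ 2 < 4)%R : nat.
have key i : (i < 2 * n)%N ->
  (\sum_(i * m <= j < i.+1 * m) s' j <= m * s i + m * count (nth_arc n i) B
  /\ m * s i <= \sum_(i * m <= j < i.+1 * m) s' j + m * count (nth_arc n i) B)%N.
  move=> i2n; have [Bi|Bi] := posnP (count (nth_arc n i) B).
    suff -> : (\sum_(i * m <= j < i.+1 * m) s' j = m * s i)%N by split; lia.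
    have -> : (m * s i = \sum_(i * m <= j < i.+1 * m) s i)%N.
      by rewrite sum_nat_const_nat mulSn addnK.
    rewrite big_nat_cond [in RHS]big_nat_cond; apply: eq_bigr => j /andP[/andP[ij ji] _]; rewrite /s /s'.
    have jm : nth_arc n i (j%:R * pi / (n * m)%:R : R).
      have nE : n%:R * (j%:R * pi / (n * m)%:R) = j%:R * pi / m%:R :> R.
        rewrite natrM; field.
        by rewrite !pnatr_eq0 -!lt0n m0.
      rewrite /nth_arc nE ler_pdivlMr ?ltr0n // ltr_pdivrMr ?ltr0n // ![_ * pi * _]mulrAC.
      by rewrite -!natrM ler_pM2r ?pi_gt0 // ltr_pM2r ?pi_gt0 // ler_nat ltr_nat ij.
    by rewrite (arc_status n0 gd i2n gB Bi jm).
  have : (\sum_(i * m <= j < i.+1 * m) s' j <= m)%N.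
    apply: (@leq_trans (\sum_(i * m <= j < i.+1 * m) 1)%N).
      by apply: leq_sum => j _; rewrite leq_b1.
    by rewrite sum_nat_const_nat; lia.
  have : (s i <= 1)%N by rewrite /s leq_b1.
  by split; nia.
have sB := sum_count_arc n (2 * n) B.
split.
  apply: (@leq_trans (\sum_(0 <= i < 2 * n) (m * s i + m * count (nth_arc n i) B))%N).
    rewrite big_nat_cond [leqRHS]big_nat_cond; apply: leq_sum => i /andP[/andP[_ /key[]]] //.
  by rewrite big_split -!big_distrr /= leq_add2l leq_mul2l sB orbT.
rewrite big_distrr /=.
apply: (@leq_trans (\sum_(0 <= i < 2 * n)
    (\sum_(i * m <= j < i.+1 * m) s' j + m * count (nth_arc n i) B))%N).
  rewrite big_nat_cond [leqRHS]big_nat_cond; apply: leq_sum => i /andP[/andP[_ /key[]]] //.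
by rewrite big_split -big_distrr /= leq_add2l leq_mul2l sB orbT.
Qed.

Local Open Scope complex_scope.

(** * Zeros on the unit circle as zeros of a real function *)

Definition expi (R : realType) (t : R) : R[i] := cos t +i* sin t.

Section Expi.
Variable R : realType.
Implicit Types (s t : R).

Lemma expiD s t : expi (s + t) = expi s * expi t.
Proof. by rewrite /expi sinD cosD; simpc; rewrite [sin s * cos t + _]addrC. Qed.

Lemma expi0 : expi 0 = 1 :> R[i].
Proof. by rewrite /expi cos0 sin0. Qed.

Lemma expiX t j : expi t ^+ j = expi (j%:R * t).
Proof.
elim: j => [|j IHj]; first by rewrite mul0r expi0.
by rewrite exprS IHj -expiD -nat1r mulrDl mul1r.
Qed.

Lemma norm_expi t : `|expi t| = 1.
Proof. by rewrite normc_def /= cos2Dsin2 sqrtr1. Qed.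

Lemma expi_neq0 t : expi t != 0.
Proof. by rewrite -normr_eq0 norm_expi oner_eq0. Qed.

Lemma expi_add t : expi t + expi (- t) = (2 * cos t)%:C.
Proof. by apply/eqP; rewrite eq_complex /= cosN sinN; apply/andP; split; apply/eqP; ring. Qed.

Lemma expi_sub t : expi t - expi (- t) = 0 +i* (2 * sin t).
Proof. by apply/eqP; rewrite eq_complex /= cosN sinN; apply/andP; split; apply/eqP; ring. Qed.

(** Equal points give [cos (t - s) = 1], hence [sin ((t - s) / 2) = 0], impossible for
    [0 < (t - s) / 2 < pi]. *)
Lemma expi_inj : {in [pred t | 0 <= t < 2 * pi] &, injective (@expi R)}.
Proof.
suff lt s t : 0 <= s -> s < t -> t < 2 * pi -> expi s <> expi t.
  move=> s t /andP[s0 s2] /andP[t0 t2] st.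
  by have [/lt|/lt|//] := ltgtP s t => H; have := H ltac:(done) ltac:(done); rewrite st.
move=> s0 st t2 [cs sn]; have : cos (t - s) = 1 by rewrite cosB cs sn -!expr2 cos2Dsin2.
have c1 : cos (t - s) = 1 - 2 * sin ((t - s) / 2) ^+ 2.
  rewrite {1}[t - s](splitr) cosD -!expr2 cos2sin2; ring.
rewrite c1 => h; have sin0 : sin ((t - s) / 2) = 0 by apply/eqP; rewrite -sqrf_eq0; apply/eqP; lra.
have : 0 < sin ((t - s) / 2) by apply: sin_gt0_pi; apply/andP; split; lra.
by rewrite sin0 ltxx.
Qed.

Definition argi (z : R[i]) : R :=
  if 0 <= complex.Im z then acos (complex.Re z) else 2 * pi - acos (complex.Re z).

Lemma argiP z : `|z| = 1 -> 0 <= argi z < 2 * pi /\ expi (argi z) = z.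
Proof.
case: z => x y; rewrite normc_def /= => /(congr1 (@complex.Re R)) /= xy1.
have xy : x ^+ 2 + y ^+ 2 = 1.
  by rewrite -[LHS]sqr_sqrtr ?addr_ge0 ?sqr_ge0 // xy1 expr1n.
have xb : -1 <= x <= 1 by apply/andP; split; nra.
have [a0 api] := (acos_ge0 xb, acos_lepi xb).
have p0 := pi_gt0 R.
have sE : sin (acos x) = `|y|.
  by rewrite sin_acos // -sqrtr_sqr; congr Num.sqrt; lra.
have cE : cos (acos x) = x by rewrite acosK.
rewrite /argi /=; have [y0|y0] := lerP 0 y.
  split; first by apply/andP; split; lra.
  by rewrite /expi cE sE ger0_norm.
(* Here [y < 0] forces [x < 1], which keeps the angle strictly below [2 pi]. *)
have a_gt0 : 0 < acos x by apply: acos_gt0; nra.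
split; first by apply/andP; split; lra.
have -> : 2 * pi - acos x = - acos x + pi *+ 2 by rewrite mulr_natl addrC.
by rewrite /expi cosD2pi sinD2pi cosN sinN cE sE ltr0_norm ?opprK.
Qed.

Lemma argi_expi t : 0 <= t < 2 * pi -> argi (expi t) = t.
Proof.
by move=> tb; have [ab ae] := argiP (norm_expi t); apply: expi_inj.
Qed.

(** Multiplicities are dropped here; [trin_excess] bounds the loss. *)
Definition angles (r : seq R[i]) : seq R :=
  [seq argi z | z <- undup r & `|z| == 1].

Lemma angles_uniq r : uniq (angles r).
Proof.
rewrite map_inj_in_uniq ?filter_uniq ?undup_uniq // => z z'.
rewrite !mem_filter => /andP[/eqP/argiP[_ zE] _] /andP[/eqP/argiP[_ zE'] _] zz'.
by rewrite -zE -zE' zz'.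
Qed.

Lemma mem_angles r t : (t \in angles r) = (0 <= t < 2 * pi) && (expi t \in r).
Proof.
apply/mapP/andP => [[z]|[tb tr]].
  rewrite mem_filter mem_undup => /andP[/eqP/argiP[zb zE] zr] ->.
  by rewrite zb zE.
by exists (expi t); rewrite ?argi_expi // mem_filter norm_expi eqxx mem_undup.
Qed.

Lemma size_angles r : size (angles r) = count (fun z => `|z| == 1) (undup r).
Proof. by rewrite size_map size_filter. Qed.

Lemma circle_root_list (p : {poly R[i]}) : p != 0 ->
  exists2 B : seq R, (size B <= size p)%N &
    forall t, 0 <= t <= 2 * pi -> root p (expi t) -> t \in B.
Proof.
move=> p0; have [r pr] := closed_field_poly_normal p.
have lc0 : lead_coef p != 0 by rewrite lead_coef_eq0.
(* [argi] never returns [2 pi], yet the closed interval contains it; the extra entry is paid for by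
   [size p] being the degree plus one. *)
exists (2 * pi :: angles r).
  rewrite /= size_angles pr size_scale // size_prod_XsubC ltnS.
  by rewrite (leq_trans (count_size _ _)) // size_undup.
move=> t /andP[t0]; rewrite le_eqVlt inE => /predU1P[->|t2]; first by rewrite eqxx.
by rewrite pr rootZ // root_prod_XsubC mem_angles t0 t2 => ->; rewrite orbT.
Qed.

End Expi.

Definition cospoly (R : realType) (k : nat) (a : nat -> int) (t : R) : R :=
  (a 0%N)%:~R + \sum_(1 <= j < k.+1) (a j)%:~R * (2 * cos (j%:R * t)).

Definition dcospoly (R : realType) (k : nat) (a : nat -> int) (t : R) : R :=
  - \sum_(1 <= j < k.+1) (a j)%:~R * (2 * j%:R * sin (j%:R * t)).

Section Link.
Variables (R : realType) (k : nat) (a : nat -> int).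
Implicit Types t : R.
Local Notation g := (@cospoly R k a).
Local Notation dg := (@dcospoly R k a).
Local Notation A := (core R[i] k a).
Local Notation D := (dcore R[i] k a).

Lemma cospoly_derive t : is_derive t (1 : R) g (dg t).
Proof.
have cosj j : is_derive t (1 : R) (fun t => cos (j%:R * t)) (- (j%:R * sin (j%:R * t))).
  have dl : is_derive t (1 : R) ( *%R (j%:R : R)) j%:R.
    have -> : *%R (j%:R : R) = j%:R \*: id by [].
    by apply: is_derive_eq; rewrite /GRing.scale /= mulr1.
  apply: (is_derive_eq (@is_derive1_comp R (@cos R) ( *%R (j%:R : R)) t _ _ _ dl)).
  by rewrite mulNr mulrC.
have sumj s : is_derive t (1 : R)
    (fun t => \sum_(j <- s) (a j)%:~R * (2 * cos (j%:R * t)))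
    (- \sum_(j <- s) (a j)%:~R * (2 * j%:R * sin (j%:R * t))).
  elim: s => [|j s IHs].
    rewrite (_ : (fun _ => _) = cst 0) ?big_nil ?oppr0; first exact: is_derive_cst.
    by apply/funext => x; rewrite big_nil.
  have -> : (fun t => \sum_(j <- j :: s) (a j)%:~R * (2 * cos (j%:R * t))) =
      ((a j)%:~R * 2) \*: (fun t => cos (j%:R * t)) +
      (fun t => \sum_(j <- s) (a j)%:~R * (2 * cos (j%:R * t))).
    by apply/funext => x; rewrite big_cons mulrA.
  apply: (is_derive_eq (is_deriveD (is_deriveZ _ (cosj j)) IHs)).
  by rewrite big_cons /GRing.scale /=; ring.
have -> : g = cst (a 0%N)%:~R + (fun t => \sum_(j <- index_iota 1 k.+1) (a j)%:~R * (2 * cos (j%:R * t))) by [].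
by apply: (is_derive_eq (is_deriveD (is_derive_cst _ _ _) (sumj _))); rewrite add0r.
Qed.

Lemma expiB_nat j t : (j <= k)%N -> expi t ^+ (k - j) = expi t ^+ k * expi (- (j%:R * t)).
Proof. by move=> jk; rewrite !expiX -expiD natrB // mulrBl. Qed.

Lemma horner_core t : A.[expi t] = expi t ^+ k * (g t)%:C.
Proof.
rewrite /core /cospoly hornerD hornerZ hornerXn horner_sum rmorphD rmorph_int rmorph_sum /= mulrDr.
rewrite mulr_sumr; congr (_ + _); first by rewrite mulrC.
rewrite big_nat_cond [in RHS]big_nat_cond; apply: eq_bigr => j /andP[/andP[_ jk] _].
rewrite hornerZ hornerD !hornerXn expiB_nat // exprD [_ ^+ j]expiX -mulrDr expi_add.
by rewrite [in RHS]rmorphM rmorph_int /= mulrCA.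
Qed.

Lemma horner_dcore t : D.[expi t] = expi t ^+ k * (0 +i* (- dg t)).
Proof.
have -> : 0 +i* (- dg t) = \sum_(1 <= j < k.+1)
    ((a j)%:~R * j%:R) * (0 +i* (2 * sin (j%:R * t))).
  rewrite /dcospoly opprK; set s := index_iota 1 k.+1.
  elim: s => [|j s IHs]; first by rewrite !big_nil.
  rewrite !big_cons -IHs -(rmorph_int (real_complex R)) -(rmorph_nat (real_complex R)).
  by apply/eqP; rewrite eq_complex /=; apply/andP; split; apply/eqP; ring.
rewrite /dcore horner_sum mulr_sumr.
rewrite big_nat_cond [in RHS]big_nat_cond; apply: eq_bigr => j /andP[/andP[_ jk] _].
rewrite hornerZ hornerD hornerN !hornerXn expiB_nat // exprD [_ ^+ j]expiX -mulrBr expi_sub.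
by rewrite mulrCA.
Qed.

Lemma horner_trin n t : (k <= n)%N ->
  (trin R[i] k a n).[expi t] = expi t ^+ n * (2 * cos (n%:R * t) + g t)%:C.
Proof.
move=> kn; rewrite trinE //; move: (A) (g t) (horner_core t) => A' G hA.
rewrite !hornerE hA mulrA -exprD subnK // rmorphD mulrDr.
congr (_ + _); by rewrite /= -expi_add mulrDr mulnC exprM expr2 !expiX -[expi _ * expi (- _)]expiD subrr expi0.
Qed.

Lemma root_trin n t : (k <= n)%N ->
  root (trin R[i] k a n) (expi t) = (2 * cos (n%:R * t) + g t == 0).
Proof.
move=> kn; rewrite rootE horner_trin // mulf_eq0 expf_eq0 (negPf (expi_neq0 _)) andbF /=.
by rewrite (fmorph_eq0 (real_complex R)).
Qed.

Lemma root_disc n t :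
  n%:R ^+ 2 * (4 - g t ^+ 2) = dg t ^+ 2 -> root (disc R[i] k a n) (expi t).
Proof.
move=> gE; rewrite rootE /disc.
move: (A) (D) (g t) (dg t) (horner_core t) (horner_dcore t) gE => A' D' G dG hA hD gE.
rewrite !hornerE hA hD mulnC exprM natrX.
set e := expi t ^+ k.
have -> : (e * (0 +i* - dG)) ^+ 2 = - e ^+ 2 * (dG ^+ 2)%:C.
  rewrite exprMn mulNr -mulrN; congr (_ * _).
  by apply/eqP; rewrite expr2 eq_complex /=; apply/andP; split; apply/eqP; ring.
rewrite -gE !(rmorphM, rmorphB, rmorphXn, rmorph_nat) /=.
apply/eqP; ring.
Qed.

Lemma root_core2 t : g t ^+ 2 = 4 -> root (A ^+ 2 - 4 *: 'X^(2 * k)) (expi t).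
Proof.
move=> gE; rewrite rootE; move: (A) (g t) (horner_core t) gE => A' G hA gE.
rewrite !hornerE hA exprMn -rmorphXn gE rmorph_nat mulnC exprM.
by rewrite mulrC subrr.
Qed.

Lemma unit_count_trin n (r : seq R[i]) : (k < n)%N -> A ^+ 2 != 4 *: 'X^(2 * k) ->
  trin R[i] k a n = \prod_(z <- r) ('X - z%:P) ->
  (count (fun z => (`|z| == 1)%R) r <= low_count n g + (28 * k + 6)
   /\ low_count n g <= count (fun z => (`|z| == 1)%R) r + (28 * k + 6))%N.
Proof.
(* Both [disc] and [A^2 - 4 X^(2k)] have size at most [4k + 1], so one list [B] of at most [8k + 1]
   angles serves for both equations. Then [3 (8k + 1)] from the arcs and [4k] from multiplicities
   stay below [28k + 6]. *)
move=> kn A2 Pr; set K := (28 * k + 6)%N.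
have F0 : disc R[i] k a n * (A ^+ 2 - 4 *: 'X^(2 * k)) != 0.
  by rewrite mulf_neq0 ?subr_eq0 // disc_neq0.
have [B sB BP] := circle_root_list F0.
have sA : (size A <= (2 * k).+1)%N by apply/leq_sizeP => i; apply: coef_core_gt.
have sA2 : (size (A ^+ 2 - 4 *: 'X^(2 * k))%R <= (4 * k).+1)%N.
  rewrite (leq_trans (size_polyD _ _)) // geq_max size_polyN; apply/andP; split.
    rewrite (leq_trans (size_poly_exp_leq _ _)) // ltnS.
    by move: sA; case: (size _) => [|s] //=; lia.
  by rewrite (leq_trans (size_scale_leq _ _)) // size_polyXn; lia.
have {}sB : (size B <= 8 * k + 1)%N.
  rewrite (leq_trans sB) // (leq_trans (size_polyMleq _ _)) //.
  by move: (size_disc R[i] k a n) sA2; move: (size _) (size _) => s1 s2; lia.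
have n0 : (0 < n)%N by lia.
have ZE t : (t \in angles r) = (0 <= t < 2 * pi) && (2 * cos (n%:R * t) + g t == 0).
  by rewrite mem_angles -root_prod_XsubC -Pr root_trin // ltnW.
have [|| c1 c2] := low_count_zeros n0 cospoly_derive (angles_uniq r) ZE (B := B).
- by move=> t tb gt; apply: BP; rewrite // rootM root_core2 ?orbT.
- by move=> t tb gt; apply: BP; rewrite // rootM root_disc.
rewrite size_angles in c1 c2.
have ex := trin_excess kn A2 Pr.
have cr := count_predC (fun z : R[i] => (`|z| == 1)%R) r.
have cu := count_predC (fun z : R[i] => (`|z| == 1)%R) (undup r).
(* Removing duplicates cannot increase the count off the circle, so the excess on the circle is at
   most the total excess. *)
have sub p : (count p (undup r) <= count p r)%N by apply/leq_count_subseq/undup_subseq.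
have s1 := sub (fun z : R[i] => (`|z| == 1)%R).
have s2 := sub (predC (fun z : R[i] => (`|z| == 1)%R)).
have arith (u u' w w' z z' b l : nat) : (b <= 8 * k + 1 -> u' <= l + 3 * b -> l <= u' + 2 * b ->
    z <= z' + 4 * k -> u + w = z -> u' + w' = z' -> u' <= u -> w' <= w ->
    u <= l + K /\ l <= u + K)%N by rewrite /K; lia.
exact: arith sB c1 c2 ex cr cu s1 s2.
Qed.
End Link.

(** * Zeros off the unit circle *)

Lemma map_trin (F F' : fieldType) (h : {rmorphism F -> F'}) k a n :
  map_poly h (trin F k a n) = trin F' k a n.
Proof.
rewrite /trin !rmorphD /= !map_polyZ !map_polyXn rmorph_int rmorph1 rmorph_sum /=.
by congr (_ + _); apply: eq_bigr => j _; rewrite map_polyZ rmorphD /= !map_polyXn rmorph_int.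
Qed.

Lemma trin_monic (F : numFieldType) (k : nat) (a : nat -> int) (n : nat) : (k < n)%N ->
  trin F k a n \is monic /\ size (trin F k a n) = (2 * n).+1.
Proof.
move=> kn; have sA : (size (core F k a) <= (2 * k).+1)%N.
  by apply/leq_sizeP => i; apply: coef_core_gt.
have lt : (size (1 + 'X^(n - k) * core F k a)%R < size ('X^(2 * n) : {poly F}))%N.
  rewrite size_polyXn ltnS (leq_trans (size_polyD _ _)) // geq_max size_poly1.
  apply/andP; split; first by lia.
  rewrite (leq_trans (size_polyMleq _ _)) // size_polyXn.
  by move: sA; move: (size _) => s; lia.
rewrite trinE ?(ltnW kn) // -addrA; split; last by rewrite size_polyDl // size_polyXn.
by rewrite monicE lead_coefDl // lead_coefXn.
Qed.

(** The case [g^2 = 4] identically: then [A = 2 e X^k] with [e = +- 1], so [P = (X^n + e)^2] and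
    every zero satisfies [z^n = - e]. *)
Lemma unit_count_degenerate (F : numFieldType) (k : nat) (a : nat -> int) (n : nat) (r : seq F) : (k < n)%N ->
  core F k a ^+ 2 = 4 *: 'X^(2 * k) ->
  trin F k a n = \prod_(z <- r) ('X - z%:P) ->
  count (fun z => `|z| == 1) r = size r.
Proof.
move=> kn A2 Pr; apply/eqP; rewrite -all_count; apply/allP => z zr.
have [e e2 AE] : exists2 e : F, e ^+ 2 = 1 & core F k a = (2 * e) *: 'X^k.
  have : (core F k a - 2 *: 'X^k) * (core F k a + 2 *: 'X^k) == 0.
    by rewrite -subr_sqr A2 subr_eq0 exprZn -exprM [(k * 2)%N]mulnC -natrX.
  rewrite mulf_eq0 subr_eq0 addr_eq0 => /orP[]/eqP ->.
    by exists 1; rewrite ?expr1n ?mulr1.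
  by exists (-1); rewrite ?sqrrN ?expr1n // mulrN1 scaleNr.
have : root (trin F k a n) z by rewrite Pr root_prod_XsubC.
rewrite trinE ?(ltnW kn) // AE -scalerAr -exprD subnK ?(ltnW kn) // rootE !hornerE.
have -> : z ^+ (2 * n) + 1 + 2 * e * z ^+ n = (z ^+ n + e) ^+ 2.
  by rewrite sqrrD e2 mulnC exprM; ring.
rewrite sqrf_eq0 addr_eq0 => /eqP zn.
rewrite -(@pexpr_eq1 _ _ n) //; last by lia.
rewrite -normrX zn normrN -(@pexpr_eq1 _ _ 2) //.
by rewrite -normrX e2 normr1.
Qed.

(** * Comparison of the off-circle counts for two values of [n] *)

Section Counts.
Variables (k : nat) (a : nat -> int).

Lemma P2n_roots n : (k < n)%N ->
  P2n k a n = \prod_(z <- roots_mult (P2n k a n)) ('X - z%:P).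
Proof.
move=> kn; rewrite /roots_mult; case: closed_field_poly_normal => r /= {1}->.
have [/monicP lc _] := @trin_monic algC k a n kn.
by rewrite (_ : lead_coef _ = 1) // scale1r.
Qed.

Lemma size_P2n_roots n : (k < n)%N -> size (roots_mult (P2n k a n)) = (2 * n)%N.
Proof.
move=> kn; have [_ sz] := @trin_monic algC k a n kn.
by apply: succn_inj; rewrite -sz -(size_prod_XsubC _ id) -P2n_roots.
Qed.

Lemma off_circle_unit n : (k < n)%N ->
  (off_circle (P2n k a n) + U_count (P2n k a n) = 2 * n)%N.
Proof.
move=> kn; rewrite -(size_P2n_roots kn) /off_circle /I_count /E_count /U_count.
elim: (roots_mult _) => //= z s <-.
have [] := real_ltgtP (normr_real z) (@real1 algC); lia.
Qed.

Lemma U_count_embed (R : realType) n (r := [seq algC_embed R z | z <- roots_mult (P2n k a n)]) :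
  (k < n)%N ->
  trin R[i] k a n = \prod_(z <- r) ('X - z%:P) /\
  U_count (P2n k a n) = count (fun z => `|z| == 1) r.
Proof.
move=> kn; split; last first.
  by rewrite /U_count count_map; apply: eq_count => z /=; rewrite norm_algC_embed_eq1.
rewrite -(map_trin (@algC_embed R)) -[trin _ _ _ _]/(P2n k a n) {1}P2n_roots //.
rewrite rmorph_prod big_map; apply: eq_bigr => z _.
by rewrite rmorphB /= map_polyX map_polyC.
Qed.

(** Up to errors linear in [n + m], both [m c n] and [n c m] equal [c (nm)]; the counts off the
    circle are the complements in [2n] and [2m]. *)
Lemma off_circle_compare (R : realType) : exists C, forall n m, (k < n)%N -> (k < m)%N ->
  (m * off_circle (P2n k a n) <= n * off_circle (P2n k a m) + (n + m) * C)%N.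
Proof.
have [A2|A2] := eqVneq (core R[i] k a ^+ 2) (4 *: 'X^(2 * k)).
  have off0 n : (k < n)%N -> off_circle (P2n k a n) = 0%N.
    move=> kn; have [Pr UE] := U_count_embed R kn.
    have := off_circle_unit kn; rewrite UE (unit_count_degenerate kn A2 Pr).
    by rewrite size_map size_P2n_roots //; lia.
  by exists 0%N => n m kn km; rewrite !off0 // muln0.
(* This [B] lists only the solutions of [g^2 = 4], so it does not depend on [n] or [m] and its size
   may enter the constant. *)
have [|B _ BP] := @circle_root_list R (core R[i] k a ^+ 2 - 4 *: 'X^(2 * k)).
  by rewrite subr_eq0.
exists (28 * k + 6 + size B)%N => n m kn km.
have gB x : 0 <= x <= 2 * pi -> cospoly k a x ^+ 2 = 4 -> x \in B.
  by move=> xb gx; apply: BP => //; apply: root_core2.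
have [[Pn Un] [Pm Um]] := (U_count_embed R kn, U_count_embed R km).
have [_ n1] := unit_count_trin kn A2 Pn.
have [m1 _] := unit_count_trin km A2 Pm.
have [n0 m0] : (0 < n)%N /\ (0 < m)%N by lia.
have [r1 _] := low_count_refine (@cospoly_derive R k a) n0 m0 gB.
have [_ r2] := low_count_refine (@cospoly_derive R k a) m0 n0 gB.
rewrite -Un in n1; rewrite -Um in m1; rewrite [(m * n)%N]mulnC in r2.
have arith (on om un um ln lm lnm b K : nat) : (on + un = 2 * n -> om + um = 2 * m ->
    ln <= un + K -> um <= lm + K -> lnm <= m * ln + m * b -> n * lm <= lnm + n * b ->
    m * on <= n * om + (n + m) * (K + b))%N by nia.
exact: arith (off_circle_unit kn) (off_circle_unit km) n1 m1 r1 r2.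
Qed.
End Counts.

From mathcomp Require Import all_boot all_algebra.
From Stdlib Require Import Reals.
Open Scope R_scope.

(* C(P_{2n}) = (I(P_{2n}) + E(P_{2n})) / (2n); the sequence is indexed by
   n = m + k + 1 (i.e. all n > k), and its limit exists in R. *)
Theorem theorem1 (k : nat) (hk : (0 < k)%nat) (a : nat -> int) :
  exists L : R,
    Un_cv (fun m : nat =>
             INR (off_circle (P2n k a (m + k + 1)%nat)) / INR (2 * (m + k + 1))%nat) L.
Proof.
(* The auxiliary [realType] is instantiated with the Stdlib reals. *)
have [C cmp] := off_circle_compare k a R.
exact: ratio_cv cmp.
Qed.
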